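(* Let $p\in\mathbb{N}$ and, for each $j\in\{1,\dots,p\}$, let $\mathbf{f}_j$ be a non-zero element of $\ell^2(\Lambda,\mathcal{M}_n)$. Let $b_o\in(0,\infty)$ be such that $$\left\|\mathcal{F}(\mathbf{f}_j)(x)\right\|_{\mathcal{M}_n}\le b_o\quad\text{for a.e. } x\in\Omega \text{ and every } j\in\{1,\dots,p\}.$$ Then the collection $\{\mathcal{D}_{2N\lambda}\mathbf{f}_j\}_{\lambda\in\Lambda,\,1\le j\le p}$ is a matrix-valued discrete Bessel sequence of non-uniform shifts with Bessel bound $2^{p-1}b_o^2n^2$.
   Context: Fix $n,N\in\mathbb{N}$ (positive integers) and an odd integer $r$ coprime to $N$ with $1\le r\le 2N-1$. Put $\Lambda=\{0,\frac{r}{N}\}+2\mathbb{Z}\subset\mathbb{R}$ and $\Omega=[0,\frac12)\cup[\frac N2,\frac{N+1}{2})$. $\mathcal{M}_n$ is the space of complex $n\times n$ matrices with norm $\|\mathbf{a}\|_{\mathcal{M}_n}=\big(\sum_{m,k=1}^n|a_{m,k}|^2\big)^{1/2}$. $\ell^2(\Lambda,\mathcal{M}_n)$ is the Hilbert space of maps $\mathbf{f}:\Lambda\to\mathcal{M}_n$ with $\sum_{\lambda\in\Lambda}\sum_{m,k=1}^n|f_{m,k}(\lambda)|^2<\infty$, with inner product $\langle\mathbf{f},\mathbf{g}\rangle=\sum_{\lambda\in\Lambda}\sum_{m,k=1}^n f_{m,k}(\lambda)\overline{g_{m,k}(\lambda)}$ and associated norm $\|\cdot\|_{\ell^2}$.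 $L^2(\Omega,\mathcal{M}_n)$ is the Hilbert space of $\mathcal{M}_n$-valued functions on $\Omega$ with entries in $L^2(\Omega)$ and inner product $\sum_{m,k}\int_\Omega F_{m,k}(x)\overline{G_{m,k}(x)}\,dx$. The Fourier transform $\mathcal{F}:\ell^2(\Lambda,\mathcal{M}_n)\to L^2(\Omega,\mathcal{M}_n)$ is defined entrywise by $\mathcal{F}(\mathbf{f})_{m,k}(x)=\sum_{\lambda\in\Lambda}f_{m,k}(\lambda)e^{2\pi i\lambda x}$ (convergence in $L^2(\Omega)$; $\{e^{2\pi i\lambda\cdot}\}_{\lambda\in\Lambda}$ is a complete orthonormal system of $L^2(\Omega)$). For $\lambda\in\Lambda$, the displacement operator $\mathcal{D}_{2N\lambda}$ on $\ell^2(\Lambda,\mathcal{M}_n)$ is $(\mathcal{D}_{2N\lambda}\mathbf{f})(\lambda')=\mathbf{f}(\lambda'-2N\lambda)$, $\lambda'\in\Lambda$. For non-zero $\mathbf{f}_1,\dots,\mathbf{f}_p\in\ell^2(\Lambda,\mathcal{M}_n)$, the collection $\{\mathcal{D}_{2N\lambda}\mathbf{f}_j\}_{\lambda\in\Lambda,\,1\le j\le p}$ is a matrix-valued discrete Bessel sequence of non-uniform shifts with Bessel bound $b\in(0,\infty)$ if $\sum_{j=1}^p\sum_{\lambda\in\Lambda}|\langle\mathbf{f},\mathcal{D}_{2N\lambda}\mathbf{f}_j\rangle|^2\le b\|\mathbf{f}\|_{\ell^2}^2$ for all $\mathbf{f}\in\ell^2(\Lambda,\mathcal{M}_n)$. 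*)

(* Defs.v *)
From mathcomp Require Import all_boot all_order all_algebra finmap.
From mathcomp Require Import all_classical all_reals all_analysis.
From mathcomp Require Import showcase.summability.
From mathcomp Require Import complex.

Set Implicit Arguments.
Unset Strict Implicit.
Unset Printing Implicit Defensive.

Import Order.TTheory GRing.Theory Num.Theory.
Import numFieldNormedType.Exports.
Import ComplexField.Normc.

Local Open Scope classical_set_scope.
Local Open Scope ring_scope.
Local Open Scope complex_scope.

Section NonuniformShifts.
Context {R : realType}.

Definition Lambda (N r : nat) : set R :=
  [set x | exists k : int, x = 2 * k%:~R \/ x = r%:R / N%:R + 2 * k%:~R].

Definition Omega (N : nat) : set R :=
  `[0, 2^-1[%classic `|` `[N%:R / 2, (N%:R + 1) / 2[%classic.

Definition Mnorm (n : nat) (a : 'M[R[i]]_n) : R :=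
  Num.sqrt (\sum_(m < n) \sum_(k < n) normc (a m k) ^+ 2).

Section Sequences.
Variables (N r n : nat).
Implicit Types f g : Lambda N r -> 'M[R[i]]_n.

Definition l2 : set (Lambda N r -> 'M[R[i]]_n) :=
  [set f | (\esum_(l in [set: Lambda N r])
     (\sum_(m < n) \sum_(k < n) normc (f l m k) ^+ 2)%:E < +oo)%E].

(* [sum] is the limit of the finite partial sums along the directed set of
   finite subsets of Lambda; it converges (absolutely) for f, g in l2. *)
Definition l2dot f g : R[i] :=
  sum (fun l : Lambda N r =>
    (\sum_(m < n) \sum_(k < n) f l m k * (g l m k)^* : R[i]^o)).

Definition l2norm f : R := Num.sqrt (complex.Re (l2dot f f)).

(* 2 N lambda is an even integer, so Lambda is stable under this shift. *)
Lemma Lambda_subr (l l' : Lambda N r) :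
  val l' - 2 * N%:R * val l \in Lambda N r.
Proof.
rewrite inE; have [z ->] : exists z : int, 2 * N%:R * val l = 2 * z%:~R.
  case: l => x /= /[!inE] -[k xE]; have [->|N0] := eqVneq N 0%N.
    by exists 0; rewrite mulr0n mulr0z mulr0 mul0r.
  have NR0 : N%:R != 0 :> R by rewrite pnatr_eq0.
  case: xE => ->.
    by exists (N%:Z * (2 * k)); rewrite !intrM -pmulrn !mulrA.
  exists (r%:Z + N%:Z * (2 * k)).
  by rewrite -mulrA mulrDr mulrCA mulfV// mulr1 intrD !intrM -!pmulrn.
case: l' => y /= /[!inE] -[k yE]; exists (k - z); case: yE => ->.
  by left; rewrite intrB mulrBr.
by right; rewrite intrB mulrBr addrA.
Qed.

Definition displacement (l : Lambda N r) f : Lambda N r -> 'M[R[i]]_n :=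
  fun l' => f (SigSub (Lambda_subr l l')).

Definition expi (l x : R) : R[i] :=
  cos (2 * pi * l * x) +i* sin (2 * pi * l * x).

Definition L2Omega : set (R -> 'M[R[i]]_n) :=
  [set F : R -> 'M[R[i]]_n | forall m k : 'I_n,
    [/\ measurable_fun (Omega N) (fun x : R => complex.Re (F x m k) : R),
        measurable_fun (Omega N) (fun x : R => complex.Im (F x m k) : R) &
        (\int[lebesgue_measure]_(x in Omega N)
           (normc (F x m k) ^+ 2)%:E < +oo)%E]].

(* F is a representative of the class in L^2(Omega, M_n) of the Fourier
   transform of f: entrywise, the finite partial sums of the series converge
   to F in L^2(Omega). *)
Definition is_fourier f (F : R -> 'M[R[i]]_n) : Prop :=
  L2Omega F /\
  forall m k : 'I_n,
    (fun A : {fset Lambda N r} =>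
       \int[lebesgue_measure]_(x in Omega N)
         (normc (F x m k -
            partial_sum (fun l : Lambda N r => f l m k * expi (val l) x) A)
          ^+ 2)%:E)%E @ totally --> 0%E.

Definition bessel_sequence (p : nat)
    (fs : 'I_p -> Lambda N r -> 'M[R[i]]_n) (b : R) : Prop :=
  0 < b /\
  forall f, l2 f ->
    (\sum_(j < p) \esum_(l in [set: Lambda N r])
       (normc (l2dot f (displacement l (fs j))) ^+ 2)%:E
     <= (b * l2norm f ^+ 2)%:E)%E.

End Sequences.
End NonuniformShifts.

(* Main.v *)
Require Import Defs.
From mathcomp Require Import all_boot all_order all_algebra finmap.
From mathcomp Require Import all_classical all_reals all_analysis.
From mathcomp Require Import measurable_realfun showcase.summability.
From mathcomp Require Import complex ring lra.

(** The proof is by duality and treats each generator separately.  Fix g = f_j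
    with Fourier transform G, a finite set L in Lambda and coefficients c_l.
    The Fourier transform turns the displacement by 2 N l into multiplication
    by the exponential of frequency 2 N l, so that the combination
    h = sum_l c_l D_(2 N l) g has Fourier transform P G, where P is the
    trigonometric polynomial with coefficients c_l and frequencies 2 N l.
    These frequencies are distinct even integers, hence differences of points
    of Lambda, so the corresponding exponentials are orthonormal on Omega, and
      |h|^2 <= int |P|^2 |G|^2 <= bo^2 int |P|^2 = bo^2 sum_l |c_l|^2
    ([matrix_displaced_le]).  Taking c_l = <f, D_(2 N l) g> the sum
    Q = sum_l |c_l|^2 equals <f, h>, and the bound on h gives Q <= bo^2 |f|^2
    ([finite_bessel], [bessel_single]).  Summing over the p generators gives
    the Bessel bound p bo^2, and p <= 2^(p-1).

    All of this is carried out on finite sums, so that the only fact of Fourier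
    analysis needed is Parseval's identity for trigonometric polynomials on
    Omega ([parseval_fset]), which rests on the vanishing of the integrals over
    Omega of the cosine and the sine of the nonzero frequencies in
    Lambda - Lambda ([gap_telescope]).  The transform G enters only as the
    L2-limit of finite partial sums: an inequality for the partial sums passes
    to G through |z + t|^2 <= (1 + e) |z|^2 + (1 + 1/e) |t|^2
    ([shift_comb_le]).  The inner products are infinite sums, reached from the
    finite ones in [sum_complex] and [bessel_single]. *)

Set Implicit Arguments.
Unset Strict Implicit.
Unset Printing Implicit Defensive.

Import Order.TTheory GRing.Theory Num.Theory.
Import numFieldNormedType.Exports.
Import ComplexField.Normc.

Local Open Scope classical_set_scope.
Local Open Scope ring_scope.

(** * Integrals of trigonometric functions *)

Section Trig.
Context {R : realType}.
Implicit Types (x y w a b : R) (z : int).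

Lemma sinD2piz x z : sin (x + 2 * pi * z%:~R) = sin x.
Proof.
have E (n : nat) y : sin (y + 2 * pi * n%:R) = sin y.
  have -> : 2 * pi * n%:R = (pi *+ 2 *+ n) :> R by ring.
  exact: (periodicn (@sinD2pi R)).
case: z => n; first exact: E.
by rewrite NegzE intrN mulrN -[LHS](E n.+1) subrK.
Qed.

Lemma cosD2piz x z : cos (x + 2 * pi * z%:~R) = cos x.
Proof. by rewrite -!sinDpihalf addrAC sinD2piz. Qed.

Lemma sinDpi_odd x (r : nat) : odd r -> sin (x + pi * r%:R) = - sin x.
Proof.
move=> ro; rewrite mulr_natr (alternatingn (@sinDpi R)).
by rewrite -signr_odd ro expr1 mulN1r.
Qed.

Lemma cosDpi_odd x (r : nat) : odd r -> cos (x + pi * r%:R) = - cos x.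
Proof.
move=> ro; rewrite mulr_natr (alternatingn (@cosDpi R)).
by rewrite -signr_odd ro expr1 mulN1r.
Qed.

Lemma continuous_cosM w : continuous (fun x : R => cos (w * x)).
Proof.
move=> x; apply: continuous_comp; last exact: continuous_cos.
by apply: cvgMr; exact: cvg_id.
Qed.

Lemma continuous_sinM w : continuous (fun x : R => sin (w * x)).
Proof.
move=> x; apply: continuous_comp; last exact: continuous_sin.
by apply: cvgMr; exact: cvg_id.
Qed.

Lemma integral_itvco_primitive (f F : R -> R) a b : a < b -> continuous f ->
  (forall x, is_derive x (1 : R) F (f x)) ->
  (\int[lebesgue_measure]_(x in `[a, b[) (f x)%:E = (F b - F a)%:E)%E.
Proof.
move=> ab cf dF.
have cF : continuous F.
  move=> x; apply/differentiable_continuous/derivable1_diffP.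
  by case: (dF x).
rewrite integral_itv_bndo_bndc; last first.
  apply/measurable_EFinP; apply: measurable_funTS.
  exact: continuous_measurable_fun.
rewrite (@continuous_FTC2 _ f F)//.
- exact: continuous_subspaceT.
- split=> [x _||]; first by case: (dF x).
  + exact/cvg_at_right_filter/cF.
  + exact/cvg_at_left_filter/cF.
- by move=> x _; rewrite derive1E; by case: (dF x).
Qed.

Lemma integral_cos a b w : a < b -> w != 0 ->
  (\int[lebesgue_measure]_(x in `[a, b[) (cos (w * x))%:E =
   ((sin (w * b) - sin (w * a)) / w)%:E)%E.
Proof.
move=> ab w0.
have dF x : is_derive x (1 : R) (fun x => w^-1 * sin (w * x)) (cos (w * x)).
  have -> : cos (w * x) = w^-1 *: (cos (w * x) *: (w *: (1 : R))).
    by rewrite /GRing.scale /=; field.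
  apply: is_deriveZ; apply: (@is_derive1_comp _ sin (fun x => w * x)).
rewrite (integral_itvco_primitive ab (@continuous_cosM w) dF).
by congr EFin; ring.
Qed.

Lemma integral_sin a b w : a < b -> w != 0 ->
  (\int[lebesgue_measure]_(x in `[a, b[) (sin (w * x))%:E =
   ((cos (w * a) - cos (w * b)) / w)%:E)%E.
Proof.
move=> ab w0.
have dF x : is_derive x (1 : R) (fun x => - w^-1 * cos (w * x)) (sin (w * x)).
  have -> : sin (w * x) = - w^-1 *: (- sin (w * x) *: (w *: (1 : R))).
    by rewrite /GRing.scale /=; field.
  apply: is_deriveZ; apply: (@is_derive1_comp _ cos (fun x => w * x)).
rewrite (integral_itvco_primitive ab (@continuous_sinM w) dF).
by congr EFin; ring.
Qed.
End Trig.

(** * Orthogonality of the exponentials on Omega *)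

Section OnOmega.
Context {R : realType}.
Variables N r : nat.
Hypotheses (N_gt0 : (0 < N)%N) (r_odd : odd r).
Local Notation mu := (@lebesgue_measure R).
Local Notation Om := (@Omega R N).
Local Notation J1 := (`[0, 2^-1[%classic : set R).
Local Notation J2 := (`[N%:R / 2, (N%:R + 1) / 2[%classic : set R).
Implicit Types (f g : R -> R) (d x u v : R).

Lemma measurable_Omega : measurable (Om : set (measurableTypeR R)).
Proof. by apply: measurableU; exact: measurable_itv. Qed.

Lemma Omega_halves : 2^-1 <= N%:R / 2 :> R.
Proof. by rewrite ler_pdivlMr// mulVf// ler1n. Qed.

Lemma Omega_disjoint :
  [disjoint J1 & J2].
Proof.
apply/disj_setPRL => x /=; rewrite !in_itv/= => /andP[x1 _] /andP[_ x2].
by have := lt_le_trans x2 Omega_halves; rewrite ltNge x1.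
Qed.

Lemma integral_Omega f : measurable_fun Om f ->
  (\int[mu]_(x in Om) (f x)%:E =
   \int[mu]_(x in J1) (f x)%:E +
   \int[mu]_(x in J2) (f x)%:E)%E.
Proof.
move=> mf; rewrite integral_setU//.
- exact/measurable_EFinP.
- exact: Omega_disjoint.
Qed.

(** Integrability travels with the value, so that finite linear combinations
    need no side conditions. *)
Definition has_integral f v :=
  mu.-integrable Om (EFin \o f) /\ (\int[mu]_(x in Om) (f x)%:E = v%:E)%E.

Lemma has_integralD f g u v : has_integral f u -> has_integral g v ->
  has_integral (fun x => f x + g x) (u + v).
Proof.
move=> [fi fu] [gi gv]; split.
  exact: (integrableD measurable_Omega fi gi).
rewrite EFinD -fu -gv -(integralD_EFin measurable_Omega fi gi)//.
Qed.

Lemma has_integralZ f u v : has_integral f u ->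
  has_integral (fun x => v * f x) (v * u).
Proof.
move=> [fi fu]; split; first exact: (integrableZl measurable_Omega v fi).
by rewrite EFinM -fu -(integralZl measurable_Omega fi).
Qed.

Lemma has_integral_sum (I : Type) (s : seq I) (f : I -> R -> R) (v : I -> R) :
  (forall i, has_integral (f i) (v i)) ->
  has_integral (fun x => \sum_(i <- s) f i x) (\sum_(i <- s) v i).
Proof.
move=> fv; elim: s => [|i s ih].
  split.
    under eq_fun do rewrite /= big_nil; exact: integrable0.
  by under eq_integral do rewrite big_nil; rewrite integral0 big_nil.
rewrite big_cons; under eq_fun do rewrite big_cons.
exact: has_integralD.
Qed.

Lemma integrable_Omega f : measurable_fun Om f -> (forall x, `|f x| <= 1) ->
  mu.-integrable Om (EFin \o f).
Proof.
move=> mf f1; apply: measurable_bounded_integrable => //.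
- exact: measurable_Omega.
- apply: (@le_lt_trans _ _ (mu J1 + mu J2)%E).
    by rewrite measureU//; apply/disj_set2P; exact: Omega_disjoint.
  by rewrite !lebesgue_measure_itv/=; do 2 case: ifPn => _;
    rewrite ?adde0 ?add0e -?EFinB -?EFinD ltry.
- exists 1; split => // M M1 x _ /=.
  exact: le_trans (f1 x) (ltW M1).
Qed.

(** The differences of two points of Lambda. *)
Definition Lambda_gap d := exists k : int,
  [\/ d = 2 * k%:~R, d = r%:R / N%:R + 2 * k%:~R |
      d = - (r%:R / N%:R + 2 * k%:~R)].

Lemma natN_neq0 : N%:R != 0 :> R.
Proof. by rewrite pnatr_eq0 -lt0n. Qed.

(** With E the cosine or the sine, this says that the integral over Omega of
    the derivative of E (2 pi d x) vanishes.  If d is an even integer then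
    E (2 pi d x) takes equal values at the two ends of each half of Omega;
    otherwise translating x by N/2 changes 2 pi d x, up to full periods, by
    pi r or - pi r, so that the contributions of the two halves cancel. *)
Lemma gap_telescope (E : R -> R) d :
  (forall x z, E (x + 2 * pi * z%:~R) = E x) ->
  (forall x, E (x + pi * r%:R) = - E x) ->
  Lambda_gap d ->
  E (2 * pi * d * 2^-1) - E (2 * pi * d * 0)
  + (E (2 * pi * d * ((N%:R + 1) / 2)) - E (2 * pi * d * (N%:R / 2))) = 0.
Proof.
move=> E2 Er [k dk].
have E2' x (z : int) : E (x - 2 * pi * z%:~R) = E x by rewrite -[LHS](E2 _ z) subrK.
have Er' x : E (x - pi * r%:R) = - E x.
  by rewrite -[in RHS](subrK (pi * r%:R) x) Er opprK.
have N0 := natN_neq0.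
have -> : 2 * pi * d * ((N%:R + 1) / 2) = 2 * pi * d * (N%:R / 2) + 2 * pi * d * 2^-1.
  by field.
rewrite mulr0 [_ * (N%:R / 2) + _]addrC; case: dk => dE.
- have -> : 2 * pi * d * 2^-1 = 2 * pi * k%:~R by rewrite dE; field.
  by have := E2 0 k; rewrite add0r addrC E2 => ->; ring.
- have -> : 2 * pi * d * (N%:R / 2) = pi * r%:R + 2 * pi * (k * N%:Z)%:~R.
    by rewrite dE intrM -pmulrn; field.
  by have := Er 0; rewrite add0r !(addrA _ (pi * r%:R)) !E2 Er => ->; ring.
- have -> : 2 * pi * d * (N%:R / 2) = - (pi * r%:R) - 2 * pi * (k * N%:Z)%:~R.
    by rewrite dE intrM -pmulrn; field.
  by have := Er' 0; rewrite sub0r !(addrA _ (- (pi * r%:R))) !E2' Er' => ->; ring.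
Qed.

Lemma Omega_itv2_lt : N%:R / 2 < (N%:R + 1) / 2 :> R.
Proof. by rewrite ltr_pM2r ?invr_gt0// ltrDl. Qed.

Lemma has_integral_cos d : d != 0 -> Lambda_gap d ->
  has_integral (fun x => cos (2 * pi * d * x)) 0.
Proof.
move=> d0 dr.
have mc : measurable_fun Om (fun x => cos (2 * pi * d * x)).
  by apply: measurable_funTS; apply: continuous_measurable_fun; exact: continuous_cosM.
have w0 : 2 * pi * d != 0 :> R by rewrite !mulf_neq0// gt_eqF// pi_gt0.
split; first by apply: integrable_Omega => // x; rewrite ler_norml cos_geN1 cos_le1.
rewrite integral_Omega// !integral_cos ?Omega_itv2_lt ?invr_gt0//.
rewrite -EFinD -mulrDl gap_telescope ?mul0r//.
- exact: sinD2piz.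
- by move=> x; rewrite sinDpi_odd.
Qed.

Lemma has_integral_sin d : d != 0 -> Lambda_gap d ->
  has_integral (fun x => sin (2 * pi * d * x)) 0.
Proof.
move=> d0 dr.
have mc : measurable_fun Om (fun x => sin (2 * pi * d * x)).
  by apply: measurable_funTS; apply: continuous_measurable_fun; exact: continuous_sinM.
have w0 : 2 * pi * d != 0 :> R by rewrite !mulf_neq0// gt_eqF// pi_gt0.
split; first by apply: integrable_Omega => // x; rewrite ler_norml sin_geN1 sin_le1.
rewrite integral_Omega// !integral_sin ?Omega_itv2_lt ?invr_gt0//.
have T := gap_telescope cosD2piz (fun x => cosDpi_odd x r_odd) dr.
rewrite -EFinD -mulrDl; congr EFin; apply/eqP; rewrite mulf_eq0; apply/orP; left.
by apply/eqP; move: T; lra.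
Qed.

Lemma has_integral1 : has_integral (fun=> 1) 1.
Proof.
split; first by apply: integrable_Omega => // x; rewrite normr1.
rewrite integral_Omega// !integral_cst//= !mul1e !lebesgue_measure_itv/=.
rewrite !lte_fin Omega_itv2_lt invr_gt0 ltr0n/= -!EFinB -EFinD.
by congr EFin; field.
Qed.

End OnOmega.

(** * Squared moduli of complex numbers *)

Section ComplexNorm.
Local Open Scope complex_scope.
Context {R : realType}.
Implicit Types (z : R[i]) (a b : R).

Lemma normc2E z : normc z ^+ 2 = complex.Re z ^+ 2 + complex.Im z ^+ 2.
Proof. by case: z => a b /=; rewrite sqr_sqrtr// addr_ge0 ?sqr_ge0. Qed.

Lemma normc_ge0 z : 0 <= normc z.
Proof. by case: z => a b /=; exact: sqrtr_ge0. Qed.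

Lemma normc2J z : normc z ^+ 2 = complex.Re (z * z^*).
Proof. by rewrite normc2E; case: z => a b /=; ring. Qed.

Lemma Re_sum (I : Type) (s : seq I) (P : pred I) (f : I -> R[i]) :
  complex.Re (\sum_(i <- s | P i) f i) = \sum_(i <- s | P i) complex.Re (f i).
Proof. by apply: (big_morph (@complex.Re R)) => // -[a b] [c d]. Qed.

Lemma Im_sum (I : Type) (s : seq I) (P : pred I) (f : I -> R[i]) :
  complex.Im (\sum_(i <- s | P i) f i) = \sum_(i <- s | P i) complex.Im (f i).
Proof. by apply: (big_morph (@complex.Im R)) => // -[a b] [c d]. Qed.

Lemma normc_sum (I : Type) (s : seq I) (f : I -> R[i]) :
  normc (\sum_(i <- s) f i) <= \sum_(i <- s) normc (f i).
Proof.
elim/big_ind2: _ => [|x a y b xa yb|//]; first by rewrite normc0.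
by apply: le_trans (le_normcD _ _) _; exact: lerD.
Qed.

Lemma normc_expi (l x : R) : normc (expi l x) = 1.
Proof.
by rewrite /= cos2Dsin2 sqrtr1.
Qed.

Lemma expiD (l l' x : R) : expi (l + l') x = expi l x * expi l' x.
Proof.
rewrite /expi mulrDr mulrDl sinD cosD; simpc.
by congr (_ +i* _); ring.
Qed.

Lemma expi_conj (l x : R) : (expi l x)^* = expi (- l) x.
Proof. by rewrite /expi /= mulrN mulNr cosN sinN. Qed.

(** Replacing Minkowski's inequality: with e arbitrarily small, an L2-small
    perturbation t changes the squared norm of z arbitrarily little, and only
    integrals of nonnegative functions are involved. *)
Lemma normcD_sqr_le (e : R) (z t : R[i]) : 0 < e ->
  normc (z + t) ^+ 2 <= (1 + e) * normc z ^+ 2 + (1 + e^-1) * normc t ^+ 2.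
Proof.
move=> e0; have := le_normcD z t.
move: (normc_ge0 (z + t)) (normc_ge0 z) (normc_ge0 t).
move: (normc (z + t)) (normc z) (normc t) => s a b s0 a0 b0 sab.
apply: le_trans (_ : (a + b) ^+ 2 <= _); first by rewrite ler_sqr ?nnegrE// addr_ge0.
rewrite -subr_ge0 (_ : _ - _ = e^-1 * (e * a - b) ^+ 2); last by field; rewrite gt_eqF.
by rewrite mulr_ge0 ?sqr_ge0// invr_ge0 ltW.
Qed.
End ComplexNorm.

(** * Parseval's identity and the displacements of Lambda *)

Section Parseval.
Local Open Scope complex_scope.
Context {R : realType}.
Variables N r : nat.
Hypotheses (N_gt0 : (0 < N)%N) (r_odd : odd r).
Local Notation mu := (@lebesgue_measure R).
Local Notation Om := (@Omega R N).
Local Notation Lam := (@Lambda R N r).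

Lemma parseval_finType (I : finType) (w : I -> R) (h : I -> R[i]) :
  (forall i j, i != j -> w i - w j != 0 /\ Lambda_gap N r (w i - w j)) ->
  has_integral N (fun x => normc (\sum_i h i * expi (w i) x) ^+ 2)
    (\sum_i normc (h i) ^+ 2).
Proof.
move=> wP.
pose c i j := h i * (h j)^*.
have -> : (fun x => normc (\sum_i h i * expi (w i) x) ^+ 2) =
  (fun x => \sum_i \sum_j
    (complex.Re (c i j) * cos (2 * pi * (w i - w j) * x) +
     - complex.Im (c i j) * sin (2 * pi * (w i - w j) * x))).
  apply/funext => x; rewrite normc2J rmorph_sum mulr_suml Re_sum.
  apply: eq_bigr => i _; rewrite mulr_sumr Re_sum; apply: eq_bigr => j _.
  transitivity (complex.Re (c i j * (expi (w i) x * (expi (w j) x)^*))).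
    by rewrite rmorphM mulrACA.
  rewrite (_ : expi _ _ * _ = expi (w i - w j) x); last first.
    by rewrite expiD -expi_conj.
  by case: (c i j) => a b /=; ring.
apply: has_integral_sum => i.
have -> : normc (h i) ^+ 2 = \sum_j (if j == i then normc (h i) ^+ 2 else 0).
  by rewrite -big_mkcond big_pred1_eq.
apply: has_integral_sum => j; case: eqVneq => [->|ji].
  rewrite -[normc _ ^+ 2]mulr1; under eq_fun => x.
    rewrite subrr mulr0 mul0r cos0 sin0 mulr0 addr0 /c -normc2J; over.
  exact/has_integralZ/has_integral1.
have [|d0 dr] := wP i j; first by rewrite eq_sym.
have := has_integralD (has_integralZ (complex.Re (c i j)) (has_integral_cos N_gt0 r_odd d0 dr))
  (has_integralZ (- complex.Im (c i j)) (has_integral_sin N_gt0 r_odd d0 dr)).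
by rewrite !mulr0 addr0.
Qed.

(** A general frequency map w serves both the exponentials of Lambda, with
    w l = l, and those coming from the displacements, with w l = 2 N l. *)
Lemma parseval_fset (T : choiceType) (w : T -> R) (D : {fset T}) (h : T -> R[i]) :
  injective w -> (forall i j, Lambda_gap N r (w i - w j)) ->
  (\int[mu]_(x in Om) (normc (\sum_(i <- D) h i * expi (w i) x) ^+ 2)%:E =
   (\sum_(i <- D) normc (h i) ^+ 2)%:E)%E.
Proof.
move=> wI wr.
have [|_] := @parseval_finType D (w \o val) (h \o val).
  move=> i j ij; split; last exact: wr.
  by rewrite subr_eq0; apply: contra_neq ij => /wI/val_inj.
rewrite (big_seq_fsetE _ _ predT (fun i => normc (h i) ^+ 2))/= => <-.
by apply: eq_integral => x _; rewrite big_seq_fsetE.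
Qed.

Lemma Lambda_mul2N (l : Lam) : exists z : int, 2 * N%:R * val l = 2 * z%:~R.
Proof.
have NR := @natN_neq0 R N N_gt0.
case: l => x /= /[!inE] -[k [->|->]].
  by exists (N%:Z * (2 * k)); rewrite !intrM -!pmulrn; ring.
exists (r%:Z + N%:Z * (2 * k)).
by rewrite intrD !intrM -!pmulrn; field.
Qed.

Lemma gap_Lambda (l l' : Lam) : Lambda_gap N r (val l - val l').
Proof.
case: l l' => [x /= /[!inE] -[k xk]] [y /= /[!inE] -[k' yk]].
case: xk yk => -> [] ->; rewrite /Lambda_gap.
- by exists (k - k'); constructor 1; rewrite intrB; ring.
- by exists (k' - k); constructor 3; rewrite intrB; ring.
- by exists (k - k'); constructor 2; rewrite intrB; ring.
- by exists (k - k'); constructor 1; rewrite intrB; ring.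
Qed.

(** The numbers 2 N l are even integers, hence the exponentials of these
    frequencies are orthonormal on Omega too. *)
Lemma gap_mul2N (l l' : Lam) :
  Lambda_gap N r (2 * N%:R * val l - 2 * N%:R * val l').
Proof.
have [z ->] := Lambda_mul2N l; have [z' ->] := Lambda_mul2N l'.
by exists (z - z'); constructor 1; rewrite intrB; ring.
Qed.

Lemma mul2N_inj : injective (fun l : Lam => 2 * N%:R * val l).
Proof.
move=> l l' /= /mulfI ll'; apply/val_inj/ll'.
by rewrite mulf_neq0// natN_neq0.
Qed.

Definition Lambda_shift (l l' : Lam) : Lam := SigSub (Lambda_subr l l').

Lemma Lambda_addr (l l' : Lam) : val l' + 2 * N%:R * val l \in Lam.
Proof.
have [z ->] := Lambda_mul2N l.
case: l' => x /= /[!inE] -[k xk]; exists (k + z); rewrite intrD.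
by case: xk => ->; [left|right]; ring.
Qed.

Definition Lambda_unshift (l l' : Lam) : Lam := SigSub (Lambda_addr l l').

Lemma Lambda_shiftK l : cancel (Lambda_shift l) (Lambda_unshift l).
Proof. by move=> l'; apply/val_inj; rewrite /= subrK. Qed.

Lemma Lambda_unshiftK l : cancel (Lambda_unshift l) (Lambda_shift l).
Proof. by move=> l'; apply/val_inj; rewrite /= addrK. Qed.

Lemma shift_reindex (A D : {fset Lam}) (l : Lam) (V : nmodType) (F : Lam -> V) :
  (forall v, v \in A -> Lambda_unshift l v \in D) ->
  \sum_(v <- A) F v =
  \sum_(m <- D) (if Lambda_shift l m \in A then F (Lambda_shift l m) else 0).
Proof.
move=> AD.
pose B := [fset Lambda_unshift l v | v in A]%fset.
have BD : (B `<=` D)%fset by apply/fsubsetP => m /imfsetP[v /= vA ->]; exact: AD.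
rewrite -(@big_fset_incl _ _ _ _ B D)//=; last first.
  move=> m mD; apply: contraNeq; case: ifPn => [sA _|_]; last by rewrite eqxx.
  by apply/imfsetP; exists (Lambda_shift l m) => //=; rewrite Lambda_shiftK.
rewrite big_imfset/=; last first.
  by move=> v v' _ _ /(congr1 (Lambda_shift l)); rewrite !Lambda_unshiftK.
by rewrite !big_seq; apply: eq_bigr => v vA; rewrite Lambda_unshiftK vA.
Qed.

End Parseval.

(** * Measurability of complex-valued functions *)

Section ComplexMeasurability.
Context {R : realType}.
Variable N : nat.
Local Notation Om := (@Omega R N).

Definition cmeasurable (F : R -> R[i]) :=
  measurable_fun (Om : set (measurableTypeR R)) (fun x => complex.Re (F x)) /\
  measurable_fun (Om : set (measurableTypeR R)) (fun x => complex.Im (F x)).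

Lemma cmeasurable_cst c : cmeasurable (fun=> c).
Proof. by split; exact: measurable_cst. Qed.

Lemma cmeasurableD F G : cmeasurable F -> cmeasurable G ->
  cmeasurable (fun x => F x + G x).
Proof.
move=> [F1 F2] [G1 G2]; split.
- rewrite (_ : (fun x => _) = (fun x => complex.Re (F x) + complex.Re (G x))).
    exact: measurable_funD.
  by apply/funext => x; case: (F x) (G x) => [a b] [c d].
- rewrite (_ : (fun x => _) = (fun x => complex.Im (F x) + complex.Im (G x))).
    exact: measurable_funD.
  by apply/funext => x; case: (F x) (G x) => [a b] [c d].
Qed.

Lemma cmeasurableM F G : cmeasurable F -> cmeasurable G ->
  cmeasurable (fun x => F x * G x).
Proof.
move=> [F1 F2] [G1 G2]; split.
- rewrite (_ : (fun x => _) = (fun x => complex.Re (F x) * complex.Re (G x)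
     - complex.Im (F x) * complex.Im (G x))).
    by apply: measurable_funB; exact: measurable_funM.
  by apply/funext => x; case: (F x) (G x) => [a b] [c d].
- rewrite (_ : (fun x => _) = (fun x => complex.Re (F x) * complex.Im (G x)
     + complex.Im (F x) * complex.Re (G x))).
    by apply: measurable_funD; exact: measurable_funM.
  by apply/funext => x; case: (F x) (G x) => [a b] [c d].
Qed.

Lemma cmeasurable_sum (I : Type) (s : seq I) (F : I -> R -> R[i]) :
  (forall i, cmeasurable (F i)) -> cmeasurable (fun x => \sum_(i <- s) F i x).
Proof.
move=> mF; elim: s => [|i s ih].
  by under eq_fun do rewrite big_nil; exact: cmeasurable_cst.
by under eq_fun do rewrite big_cons; exact: cmeasurableD.
Qed.

Lemma cmeasurable_expi (w : R) : cmeasurable (expi w).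
Proof.
split; apply: measurable_funTS; apply: continuous_measurable_fun.
- exact: continuous_cosM.
- exact: continuous_sinM.
Qed.

Lemma cmeasurable_trig (T : Type) (s : seq T) (h : T -> R[i]) (w : T -> R) :
  cmeasurable (fun x => \sum_(t <- s) h t * expi (w t) x).
Proof.
apply: cmeasurable_sum => t; apply: cmeasurableM.
- exact: cmeasurable_cst.
- exact: cmeasurable_expi.
Qed.

Lemma measurable_normc2 F : cmeasurable F ->
  measurable_fun (Om : set (measurableTypeR R)) (fun x => normc (F x) ^+ 2).
Proof.
move=> [F1 F2]; under eq_fun do rewrite normc2E.
by apply: measurable_funD; exact: measurable_funX.
Qed.

End ComplexMeasurability.

(** * Combinations of displaced sequences on the Fourier side *)

Section DisplacedCombinations.
Local Open Scope complex_scope.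
Context {R : realType}.
Variables N r : nat.
Hypotheses (N_gt0 : (0 < N)%N) (r_odd : odd r).
Local Notation mu := (@lebesgue_measure R).
Local Notation Om := (@Omega R N).
Local Notation Lam := (@Lambda R N r).
Variables (L : {fset Lam}) (c : Lam -> R[i]).

Definition trigpoly (x : R) : R[i] := \sum_(l <- L) c l * expi (2 * N%:R * val l) x.

Definition shift_comb (u : Lam -> R[i]) (m : Lam) : R[i] := \sum_(l <- L) c l * u (Lambda_shift l m).

Definition fourier_sum (u : Lam -> R[i]) (A : {fset Lam}) (x : R) :=
  partial_sum (fun l : Lam => u l * expi (val l) x) A.

Definition truncate (u : Lam -> R[i]) (A : {fset Lam}) (l : Lam) : R[i] :=
  if l \in A then u l else 0.

Lemma fourier_sumE u A x : fourier_sum u A x = \sum_(l <- A) u l * expi (val l) x.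
Proof. by rewrite big_seq_fsetE. Qed.

(** Multiplying by the exponential of frequency 2 N l displaces the
    coefficients by 2 N l. *)
Lemma trigpoly_fourier_sum u (A D : {fset Lam}) x :
  (forall l v, l \in L -> v \in A -> Lambda_unshift N_gt0 l v \in D) ->
  trigpoly x * fourier_sum u A x =
  \sum_(m <- D) shift_comb (truncate u A) m * expi (val m) x.
Proof.
move=> LAD; rewrite fourier_sumE mulr_suml.
under [RHS]eq_bigr do rewrite mulr_suml.
rewrite exchange_big/= [LHS]big_seq [RHS]big_seq; apply: eq_bigr => l lL.
rewrite mulr_sumr [LHS](shift_reindex (N_gt0 := N_gt0) (D := D) (l := l));
  last by move=> v vA; apply: LAD.
apply: eq_bigr => m _; rewrite /truncate; case: ifPn => _; last by rewrite mulr0 mul0r.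
rewrite mulrACA -expiD; congr (_ * expi _ x).
by rewrite /= addrC subrK.
Qed.

(** Parseval's identity for the coefficients of the product, of which only
    those indexed by B are kept. *)
Lemma shift_comb_truncate_le u (A B : {fset Lam}) :
  ((\sum_(m <- B) normc (shift_comb (truncate u A) m) ^+ 2)%:E <=
   \int[mu]_(x in Om) (normc (trigpoly x * fourier_sum u A x) ^+ 2)%:E)%E.
Proof.
(* D contains every frequency of the product, and B. *)
pose D := (B `|` [fset Lambda_unshift N_gt0 l v | l in L, v in A])%fset.
have LAD l v : l \in L -> v \in A -> Lambda_unshift N_gt0 l v \in D.
  by move=> lL vA; rewrite inE; apply/orP; right; apply/imfset2P; exists l => //; exists v.
under eq_integral do rewrite (trigpoly_fourier_sum u _ LAD).
rewrite (parseval_fset (r := r) N_gt0 r_odd)//; last exact: gap_Lambda.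
rewrite lee_fin [leRHS](big_fsetID _ (mem B))/=.
rewrite [X in _ <= X + _](_ :
    _ = \sum_(m <- B) normc (shift_comb (truncate u A) m) ^+ 2).
  by rewrite lerDl sumr_ge0// => m _; exact: sqr_ge0.
by apply: eq_fbigl => m; rewrite !inE/=; case: (m \in B) => //=; rewrite andbF.
Qed.

Lemma normc_trigpoly_le x : normc (trigpoly x) <= \sum_(l <- L) normc (c l).
Proof.
apply: le_trans (normc_sum _ _) _; apply: ler_sum => l _.
by rewrite normcM normc_expi mulr1.
Qed.

Lemma integral_trigpoly :
  (\int[mu]_(x in Om) (normc (trigpoly x) ^+ 2)%:E =
   (\sum_(l <- L) normc (c l) ^+ 2)%:E)%E.
Proof.
apply: (parseval_fset (r := r) N_gt0 r_odd).
- exact: mul2N_inj.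
- exact: gap_mul2N.
Qed.

Lemma cmeasurable_trigpoly : cmeasurable N trigpoly.
Proof. exact: cmeasurable_trig. Qed.

Lemma cmeasurable_fourier_sum u A : cmeasurable N (fourier_sum u A).
Proof.
rewrite (_ : fourier_sum u A = fun x => \sum_(l <- A) u l * expi (val l) x).
  exact: cmeasurable_trig.
by apply/funext => x; rewrite fourier_sumE.
Qed.

(** Passing from the partial sums to their L2-limit G: the trigonometric
    polynomial is bounded by the sum of the moduli of its coefficients. *)
Lemma trigpoly_split_le u A (G : R -> R[i]) (e : R) : cmeasurable N G -> 0 < e ->
  (\int[mu]_(x in Om) (normc (trigpoly x * fourier_sum u A x) ^+ 2)%:E <=
   (1 + e)%:E * \int[mu]_(x in Om) (normc (trigpoly x * G x) ^+ 2)%:E +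
   ((1 + e^-1) * (\sum_(l <- L) normc (c l)) ^+ 2)%:E *
   \int[mu]_(x in Om) (normc (G x - fourier_sum u A x) ^+ 2)%:E)%E.
Proof.
move=> mG e0; set K := \sum_(l <- L) _.
have mP := cmeasurable_trigpoly; have mS := cmeasurable_fourier_sum u A.
have mO := @measurable_Omega R N.
have mPS := measurable_normc2 (cmeasurableM mP mS).
have mPG := measurable_normc2 (cmeasurableM mP mG).
have mGS : measurable_fun (Om : set (measurableTypeR R))
    (fun x => normc (G x - fourier_sum u A x) ^+ 2).
  apply: measurable_normc2; apply: cmeasurableD => //.
  under eq_fun do rewrite -mulN1r.
  by apply: cmeasurableM => //; exact: cmeasurable_cst.
have K0 : 0 <= (1 + e^-1) * K ^+ 2 by rewrite mulr_ge0 ?sqr_ge0// addr_ge0// invr_ge0 ltW.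
have e1 : 0 <= 1 + e by rewrite addr_ge0// ltW.
have sq (z : R[i]) : (0 <= (normc z ^+ 2)%:E)%E by rewrite lee_fin sqr_ge0.
rewrite -ge0_integralZl_EFin//; last exact/measurable_EFinP.
rewrite -ge0_integralZl_EFin//; last exact/measurable_EFinP.
rewrite -ge0_integralD//.
- apply: ge0_le_integral => //.
  + exact/measurable_EFinP.
  + apply/measurable_EFinP.
    by apply: measurable_funD; apply: measurable_funM => //; exact: measurable_cst.
  + move=> x _; rewrite -!EFinM -EFinD lee_fin.
    set p := trigpoly x; set s := fourier_sum u A x.
    have -> : p * s = p * G x + p * (s - G x) by ring.
    apply: le_trans (normcD_sqr_le _ _ e0) _; rewrite lerD2l -mulrA.
    rewrite ler_wpM2l ?addr_ge0 ?invr_ge0 ?(ltW e0)//.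
    rewrite normcM exprMn (_ : normc (s - G x) = normc (G x - s)); last first.
      by rewrite -normcN opprB.
    rewrite ler_wpM2r ?sqr_ge0// ler_sqr ?nnegrE ?normc_ge0//.
      exact: normc_trigpoly_le.
    by rewrite sumr_ge0// => l _; exact: normc_ge0.
- by move=> x _; rewrite mule_ge0.
- by apply/measurable_EFinP/measurable_funM => //; exact: measurable_cst.
- by move=> x _; rewrite mule_ge0.
- by apply/measurable_EFinP/measurable_funM => //; exact: measurable_cst.
Qed.

End DisplacedCombinations.

(** The limit d -> 0, and then e -> 0. *)
Lemma le_of_weighted_le {R : realType} (a K : R) (X : \bar R) :
  0 <= K -> (0 <= X)%E ->
  (forall e d : R, 0 < e -> 0 < d ->
     (a%:E <= (1 + e)%:E * X + ((1 + e^-1) * K)%:E * d%:E)%E) ->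
  (a%:E <= X)%E.
Proof.
move=> K0; case: X => [x|_ _|//]; last by rewrite leey.
rewrite lee_fin => x0 H; rewrite lee_fin; apply/ler_addgt0Pr => t t0.
(* e and d are chosen so that e * x and C * d, with C the factor of d, are
   both at most t / 2. *)
pose e := t / (2 * (x + 1)); have x1 : 0 < x + 1 by rewrite ltr_wpDl.
have e0 : 0 < e by rewrite divr_gt0// mulr_gt0.
pose C := (1 + e^-1) * K; have C0 : 0 <= C.
  by rewrite mulr_ge0// addr_ge0// invr_ge0 ltW.
have C1 : 0 < C + 1 by rewrite ltr_wpDl.
have d0 : 0 < t / (2 * (C + 1)) by rewrite divr_gt0// mulr_gt0.
have := H e _ e0 d0; rewrite -/C -!EFinM -EFinD lee_fin => /le_trans; apply.
have -> : C * (t / (2 * (C + 1))) = t / 2 - t / (2 * (C + 1)).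
  by field; rewrite gt_eqF.
have -> : (1 + e) * x = x + t / 2 - e.
  by rewrite /e; field; rewrite gt_eqF.
have := e0; have := d0; set s := t / (2 * (C + 1)); move=> s0 _; lra.
Qed.

Section DisplacedBound.
Local Open Scope complex_scope.
Context {R : realType}.
Variables N r : nat.
Hypotheses (N_gt0 : (0 < N)%N) (r_odd : odd r).
Local Notation mu := (@lebesgue_measure R).
Local Notation Om := (@Omega R N).
Local Notation Lam := (@Lambda R N r).
Variables (L : {fset Lam}) (c : Lam -> R[i]).

(** The left-hand side only sees u at the finitely many points Lambda_shift l m with
    l in L and m in B, so that u may be truncated to any finite set containing
    them; truncating to larger and larger sets brings in the L2-limit G. *)
Lemma shift_comb_le (u : Lam -> R[i]) (G : R -> R[i]) (B : {fset Lam}) :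
  cmeasurable N G ->
  ((fun A : {fset Lam} => \int[mu]_(x in Om) (normc (G x - fourier_sum u A x) ^+ 2)%:E)%E
     @ totally --> 0%E) ->
  ((\sum_(m <- B) normc (shift_comb L c u m) ^+ 2)%:E <=
   \int[mu]_(x in Om) (normc (trigpoly L c x * G x) ^+ 2)%:E)%E.
Proof.
move=> mG cvG; apply: (@le_of_weighted_le _ _ ((\sum_(l <- L) normc (c l)) ^+ 2)).
- exact: sqr_ge0.
- by apply: integral_ge0 => x _; rewrite lee_fin sqr_ge0.
move=> e d e0 d0; have FF := @totally_filter Lam.
have nearB : \forall A \near @totally Lam,
    (([fset Lambda_shift l m | l in L, m in B] : {fset Lam}) `<=` A)%fset.
  by exists [fset Lambda_shift l m | l in L, m in B]%fset.
have neard : \forall A \near @totally Lam,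
    (\int[mu]_(x in Om) (normc (G x - fourier_sum u A x) ^+ 2)%:E < d%:E)%E.
  exact: cvG _ (@nbhs_open_ereal_lt _ 0 (fun=> d) d0).
have [A [/fsubsetP BA Ad]] := filter_ex (filterI nearB neard).
have -> : \sum_(m <- B) normc (shift_comb L c u m) ^+ 2 =
          \sum_(m <- B) normc (shift_comb L c (truncate u A) m) ^+ 2.
  rewrite !big_seq; apply: eq_bigr => m mB; congr (normc _ ^+ 2).
  rewrite /shift_comb !big_seq; apply: eq_bigr => l lL; congr (_ * _).
  rewrite /truncate ifT//; apply: BA.
  by apply/imfset2P; exists l => //; exists m.
apply: le_trans (shift_comb_truncate_le N_gt0 r_odd L c u A B) _.
apply: le_trans (trigpoly_split_le L c u A mG e0) _.
rewrite leeD2l// lee_wpmul2l//; last exact: ltW.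
by rewrite lee_fin mulr_ge0 ?sqr_ge0// addr_ge0// invr_ge0 ltW.
Qed.

(** The only place where the bound on the Fourier transform enters: the moduli
    of the entries of G recombine into its Hilbert-Schmidt norm, and the
    trigonometric polynomial that remains is integrated by Parseval. *)
Lemma matrix_displaced_le (n : nat) (g : Lam -> 'M[R[i]]_n) (G : R -> 'M[R[i]]_n)
    (bo : R) (B : {fset Lam}) :
  0 < bo ->
  is_fourier g G ->
  {ae mu, forall x, Om x -> Mnorm (G x) <= bo} ->
  \sum_(m <- B) \sum_(i < n) \sum_(j < n) normc (shift_comb L c (fun l => g l i j) m) ^+ 2
  <= bo ^+ 2 * \sum_(l <- L) normc (c l) ^+ 2.
Proof.
move=> bo0 [mG cvG] Gbo.
have mO := @measurable_Omega R N.
have mGij i j : cmeasurable N (fun x => G x i j) by have [] := mG i j.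
have mP := cmeasurable_trigpoly L c.
have mPG i j := measurable_normc2 (cmeasurableM mP (mGij i j)).
rewrite -lee_fin (_ : (\sum_(m <- B) _)%:E = (\sum_(i < n) \sum_(j < n)
    (\sum_(m <- B) normc (shift_comb L c (fun l => g l i j) m) ^+ 2)%:E)%E); last first.
  rewrite exchange_big/= -sumEFin; apply: eq_bigr => i _.
  by rewrite exchange_big/= -sumEFin.
apply: (@le_trans _ _ (\sum_(i < n) \sum_(j < n)
   \int[mu]_(x in Om) (normc (trigpoly L c x * G x i j) ^+ 2)%:E)%E).
  apply: lee_sum => i _; apply: lee_sum => j _.
  by apply: shift_comb_le => //; exact: cvG.
have sq (z : R[i]) : (0 <= (normc z ^+ 2)%:E)%E by rewrite lee_fin sqr_ge0.
under eq_bigr => i _.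
  rewrite -ge0_integral_sum//; last by move=> j; exact/measurable_EFinP.
  over.
rewrite -ge0_integral_sum//; last 2 first.
- by move=> i; apply: emeasurable_sum => j; exact/measurable_EFinP.
- by move=> i x _; apply: sume_ge0.
rewrite EFinM -(integral_trigpoly N_gt0 r_odd).
rewrite -ge0_integralZl_EFin//; last 2 first.
- by apply/measurable_EFinP; exact: measurable_normc2.
- exact: sqr_ge0.
apply: ae_ge0_le_integral => //.
- by move=> x _; apply: sume_ge0 => i _; apply: sume_ge0.
- by apply: emeasurable_sum => i; apply: emeasurable_sum => j; exact/measurable_EFinP.
- by move=> x _; rewrite mule_ge0// lee_fin sqr_ge0.
- apply/measurable_EFinP; apply: measurable_funM; first exact: measurable_cst.
  exact: measurable_normc2.
have [Z [mZ Z0 subZ]] := Gbo; exists Z; split => // x /= nx; apply: subZ => /= Gx.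
apply: nx => Ox; have {Gx} Gx := Gx Ox.
under eq_bigr do rewrite sumEFin; rewrite sumEFin -EFinM lee_fin.
under eq_bigr do (under eq_bigr do rewrite normcM exprMn; rewrite -mulr_sumr).
rewrite -mulr_sumr mulrC ler_wpM2r ?sqr_ge0//.
have S0 : 0 <= \sum_(i < n) \sum_(j < n) normc (G x i j) ^+ 2.
  by apply: sumr_ge0 => i _; apply: sumr_ge0 => j _; exact: sqr_ge0.
rewrite -(sqr_sqrtr S0) ler_sqr ?nnegrE ?sqrtr_ge0//; exact: ltW.
Qed.

End DisplacedBound.

(** * Sums along the finite subsets of a set *)

Section SumsAlongFinsets.
Local Open Scope complex_scope.
Context {R : realType} {I : choiceType}.

Lemma ler_sum_fset (y : I -> R) (A B : {fset I}) :
  (forall i, 0 <= y i) -> (A `<=` B)%fset ->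
  \sum_(i <- A) y i <= \sum_(i <- B) y i.
Proof.
move=> y0 AB; rewrite [leRHS](big_fsetID _ (mem A))/=.
rewrite [X in _ <= X + _](_ : _ = \sum_(i <- A) y i).
  by rewrite lerDl sumr_ge0.
by apply: eq_fbigl => i; rewrite !inE/= -(@in_fsetI _ B A) (fsetIidPr _).
Qed.

Lemma cvg_sum_nneg (y : I -> R) (M : R) : (forall i, 0 <= y i) ->
  (forall A : {fset I}, \sum_(i <- A) y i <= M) ->
  exists2 l : R, (fun A : {fset I} => \sum_(i <- A) y i) @ totally --> l &
    forall A : {fset I}, \sum_(i <- A) y i <= l.
Proof.
move=> y0 yM; pose S := range (fun A : {fset I} => \sum_(i <- A) y i).
have S0 : S !=set0 by exists (\sum_(i <- fset0) y i); exists fset0.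
have SM : has_ubound S by exists M => _ [A _ <-].
have FF := @totally_filter I.
have leS (A : {fset I}) : \sum_(i <- A) y i <= sup S by apply: ub_le_sup => //; exists A.
exists (sup S) => //; apply/cvgrPdist_le => e e0.
have [_ [A _ <-] Ae] := sup_adherent e0 (conj S0 SM).
exists A => // B /= AB.
have := ler_sum_fset y0 AB; have := leS B.
set s := \sum_(i <- B) y i; move=> sS As; rewrite ger0_norm ?subr_ge0//.
by move: As Ae; lra.
Qed.

Lemma normc_le_ReIm (z : R[i]) : normc z <= `|complex.Re z| + `|complex.Im z|.
Proof.
rewrite -ler_sqr ?nnegrE ?normc_ge0 ?addr_ge0// normc2E sqrrD !real_normK ?num_real//.
by rewrite -addrA addrCA [leRHS]addrC lerDl mulrn_wge0// mulr_ge0.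
Qed.

Lemma Re_normc_le (z : R[i]) : `|complex.Re z| <= normc z.
Proof.
by rewrite -ler_sqr ?nnegrE ?normc_ge0// normc2E real_normK ?num_real// lerDl sqr_ge0.
Qed.

Lemma Im_normc_le (z : R[i]) : `|complex.Im z| <= normc z.
Proof.
by rewrite -ler_sqr ?nnegrE ?normc_ge0// normc2E real_normK ?num_real// lerDr sqr_ge0.
Qed.

(** A dominated family is the difference of the nonnegative families y + t
    and t. *)
Lemma cvg_sum_dominated (y t : I -> R) (M : R) : (forall i, `|y i| <= t i) ->
  (forall A : {fset I}, \sum_(i <- A) t i <= M) ->
  exists l : R, (fun A : {fset I} => \sum_(i <- A) y i) @ totally --> l.
Proof.
move=> yt tM; have FF := @totally_filter I.
have t0 i : 0 <= t i := le_trans (normr_ge0 _) (yt i).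
have [l1 l1P _] := cvg_sum_nneg t0 tM.
have [||l2 l2P _] := @cvg_sum_nneg (fun i => y i + t i) (M + M).
- by move=> i; have := yt i; rewrite ler_norml => /andP[]; lra.
- move=> A; rewrite big_split/= lerD//; apply: le_trans (tM A).
  by apply: ler_sum => i _; apply: le_trans (yt i); exact: ler_norm.
exists (l2 - l1).
rewrite (_ : (fun A : {fset I} => _) =
    (fun A : {fset I} => \sum_(i <- A) (y i + t i) - \sum_(i <- A) t i)).
  exact: cvgB.
by apply/funext => A; rewrite big_split/= addrK.
Qed.

(** Real and imaginary parts are summed separately; this exhibits the limit,
    without appeal to the completeness of the complex numbers. *)
Lemma sum_complex (x : I -> R[i]) (M : R) :
  (forall A : {fset I}, \sum_(i <- A) normc (x i) <= M) ->
  exists a b : R,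
    [/\ (fun A : {fset I} => complex.Re (\sum_(i <- A) x i)) @ totally --> a,
        (fun A : {fset I} => complex.Im (\sum_(i <- A) x i)) @ totally --> b &
        sum (x : I -> R[i]^o) = a +i* b].
Proof.
move=> xM; have FF := @totally_filter I.
have [a aP] := cvg_sum_dominated (fun i => Re_normc_le (x i)) xM.
have [b bP] := cvg_sum_dominated (fun i => Im_normc_le (x i)) xM.
exists a, b.
have aP' : (fun A : {fset I} => complex.Re (\sum_(i <- A) x i)) @ totally --> a.
  by under eq_fun do rewrite Re_sum.
have bP' : (fun A : {fset I} => complex.Im (\sum_(i <- A) x i)) @ totally --> b.
  by under eq_fun do rewrite Im_sum.
split => //; rewrite /sum; apply: norm_cvg_lim; apply/cvgrPdist_le => e.
case: e => e e'; rewrite ltcE/= => /andP[/eqP -> e0].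
have e20 : 0 < e / 2 by rewrite divr_gt0.
move/cvgrPdist_le : aP' => /(_ _ e20) aP'.
move/cvgrPdist_le : bP' => /(_ _ e20) bP'.
apply: filterS2 aP' bP' => A; rewrite /partial_sum -(big_seq_fsetE _ A predT x)/=.
set s := \sum_(i <- A) x i => sa sb; rewrite normc_def lecR.
rewrite -normc2E sqrtr_sqr ger0_norm ?normc_ge0//; apply: le_trans (normc_le_ReIm _) _.
by case: s sa sb => s1 s2 /=; lra.
Qed.

Lemma sum_fset_le_esum (a : I -> R) (A : {fset I}) :
  ((\sum_(i <- A) a i)%:E <= \esum_(i in [set: I]) (a i)%:E)%E.
Proof.
apply: ereal_sup_ubound; exists [set` A]; first by split.
by rewrite fsbig_finite//= set_fsetK sumEFin.
Qed.

Lemma esum_le (a : I -> R) (M : R) :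
  (forall A : {fset I}, \sum_(i <- A) a i <= M) ->
  (\esum_(i in [set: I]) (a i)%:E <= M%:E)%E.
Proof.
move=> aM; apply: ge_ereal_sup => _ [S [fS _] <-].
by rewrite fsbig_finite//= sumEFin lee_fin.
Qed.

End SumsAlongFinsets.

(** * The Bessel inequality *)

Section Bessel.
Local Open Scope complex_scope.
Context {R : realType}.
Variables N r n : nat.
Hypotheses (N_gt0 : (0 < N)%N) (r_odd : odd r).
Local Notation mu := (@lebesgue_measure R).
Local Notation Om := (@Omega R N).
Local Notation Lam := (@Lambda R N r).
Implicit Types (f g : Lam -> 'M[R[i]]_n).

Definition hsdot (a b : 'M[R[i]]_n) : R[i] :=
  \sum_(i < n) \sum_(j < n) a i j * conjc (b i j).

Definition hsnorm2 (a : 'M[R[i]]_n) : R := \sum_(i < n) \sum_(j < n) normc (a i j) ^+ 2.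

Lemma hsnorm2_ge0 a : 0 <= hsnorm2 a.
Proof. by apply: sumr_ge0 => i _; apply: sumr_ge0 => j _; exact: sqr_ge0. Qed.

Lemma normc_conj (z : R[i]) : normc (conjc z) = normc z.
Proof. by case: z => a b /=; rewrite sqrrN. Qed.

Lemma normc_hsdot_le a b : normc (hsdot a b) <= hsnorm2 a + hsnorm2 b.
Proof.
apply: le_trans (normc_sum _ _) _; rewrite /hsnorm2 -big_split/=.
apply: ler_sum => i _; apply: le_trans (normc_sum _ _) _; rewrite -big_split/=.
apply: ler_sum => j _; rewrite normcM normc_conj.
move: (normc_ge0 (a i j)) (normc_ge0 (b i j)).
by move: (normc (a i j)) (normc (b i j)) => x y x0 y0; nra.
Qed.

Lemma Re_hsdotxx a : complex.Re (hsdot a a) = hsnorm2 a.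
Proof.
rewrite /hsdot Re_sum; apply: eq_bigr => i _; rewrite Re_sum; apply: eq_bigr => j _.
by rewrite normc2J.
Qed.

Lemma l2_bounded f : l2 f -> exists M, forall A : {fset Lam}, \sum_(l <- A) hsnorm2 (f l) <= M.
Proof.
rewrite /l2 /= => fl2; exists (fine (\esum_(l in [set: Lam]) (hsnorm2 (f l))%:E)%E) => A.
rewrite -lee_fin fineK; first exact: sum_fset_le_esum.
rewrite ge0_fin_numE//; apply: esum_ge0 => l _.
by rewrite lee_fin hsnorm2_ge0.
Qed.

Lemma sum_shift_le f M (l : Lam) : (forall A : {fset Lam}, \sum_(m <- A) hsnorm2 (f m) <= M) ->
  forall A : {fset Lam}, \sum_(m <- A) hsnorm2 (f (Lambda_shift l m)) <= M.
Proof.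
move=> fM A; apply: le_trans (fM [fset Lambda_shift l m | m in A]%fset).
rewrite big_imfset//= => m m' _ _ mm'.
by rewrite -(Lambda_shiftK N_gt0 l m) mm' Lambda_shiftK.
Qed.

Lemma Re_mulJ_le (t : R) (z w : R[i]) : 0 < t ->
  2 * complex.Re (conjc z * w) <= t * normc z ^+ 2 + t^-1 * normc w ^+ 2.
Proof.
move=> t0; rewrite !normc2E; case: z w => [a b] [c d] /=.
rewrite -subr_ge0 (_ : _ - _ = t^-1 * ((t * a - c) ^+ 2 + (t * b - d) ^+ 2)); last first.
  by field; rewrite gt_eqF.
by rewrite mulr_ge0 ?addr_ge0 ?sqr_ge0// invr_ge0 ltW.
Qed.

(** Duality: with c_l the finite partial sums of the inner products, the sum Q
    of the |c_l|^2 is the inner product of f with the combination of the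
    displaced g of coefficients c_l, restricted to A.  The square norm H of
    this combination is at most bo^2 Q by [matrix_displaced_le], so that the
    weighted inequality 2 Q <= bo^2 F + bo^-2 H gives Q <= bo^2 F. *)
Lemma finite_bessel g (G : R -> 'M[R[i]]_n) (bo : R) f (L A : {fset Lam}) :
  0 < bo -> is_fourier g G ->
  {ae mu, forall x, Om x -> Mnorm (G x) <= bo} ->
  \sum_(l <- L) normc (\sum_(m <- A) hsdot (f m) (g (Lambda_shift l m))) ^+ 2 <=
  bo ^+ 2 * \sum_(m <- A) hsnorm2 (f m).
Proof.
move=> bo0 gG Gbo; pose c l := \sum_(m <- A) hsdot (f m) (g (Lambda_shift l m)).
set Q := \sum_(l <- L) _; set F := \sum_(m <- A) _.
have HQ := matrix_displaced_le N_gt0 r_odd L c A bo0 gG Gbo.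
set H := \sum_(m <- A) _ in HQ; rewrite -/Q in HQ.
have t0 : 0 < bo ^+ 2 by rewrite exprn_gt0.
have QE : Q = \sum_(m <- A) \sum_(i < n) \sum_(j < n)
    complex.Re (conjc (f m i j) * shift_comb L c (fun l => g l i j) m).
  transitivity (complex.Re (\sum_(m <- A) \sum_(i < n) \sum_(j < n)
      conjc (f m i j) * shift_comb L c (fun l => g l i j) m)); last first.
    rewrite Re_sum; apply: eq_bigr => m _; rewrite Re_sum; apply: eq_bigr => i _.
    by rewrite Re_sum.
  rewrite /Q; under eq_bigr do rewrite normc2J; rewrite -Re_sum; congr complex.Re.
  transitivity (\sum_(l <- L) \sum_(m <- A) \sum_(i < n) \sum_(j < n)
      c l * (conjc (f m i j) * g (Lambda_shift l m) i j)).
    apply: eq_bigr => l _; rewrite rmorph_sum mulr_sumr; apply: eq_bigr => m _.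
    rewrite rmorph_sum mulr_sumr; apply: eq_bigr => i _.
    rewrite rmorph_sum mulr_sumr; apply: eq_bigr => j _.
    by rewrite rmorphM; congr (_ * (_ * _)); exact: conjcK.
  rewrite exchange_big; apply: eq_bigr => m _.
  rewrite exchange_big; apply: eq_bigr => i _.
  rewrite exchange_big; apply: eq_bigr => j _.
  by rewrite mulr_sumr; apply: eq_bigr => l _; rewrite mulrCA.
have : 2 * Q <= bo ^+ 2 * F + (bo ^+ 2)^-1 * H.
  rewrite QE /F /H !mulr_sumr -big_split/=; apply: ler_sum => m _.
  rewrite /hsnorm2 !mulr_sumr -big_split/=; apply: ler_sum => i _.
  rewrite !mulr_sumr -big_split/=; apply: ler_sum => j _.
  exact: Re_mulJ_le.
have : (bo ^+ 2)^-1 * H <= Q by rewrite mulrC ler_pdivrMr// mulrC.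
lra.
Qed.

Lemma cvg_sum_seq (I : Type) (s : seq I) (J : choiceType) (y : I -> {fset J} -> R) (l : I -> R) :
  (forall i, y i @ totally --> l i) ->
  (fun A => \sum_(i <- s) y i A) @ totally --> \sum_(i <- s) l i.
Proof.
move=> yl; have FF := @totally_filter J; elim: s => [|i s ih].
  by rewrite big_nil; under eq_fun do rewrite big_nil; exact: cvg_cst.
by rewrite big_cons; under eq_fun do rewrite big_cons; exact: cvgD.
Qed.

(** The partial sums increase to their limit, which is the square norm. *)
Lemma l2norm2_ge f : l2 f -> forall A : {fset Lam}, \sum_(m <- A) hsnorm2 (f m) <= l2norm f ^+ 2.
Proof.
move=> fl2 A; have [M fM] := l2_bounded fl2; have FF := @totally_filter Lam.
have [|a [b [aP _ dotE]]] := @sum_complex R Lam (fun m => hsdot (f m) (f m)) (M + M).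
  move=> B; apply: le_trans (lerD (fM B) (fM B)); rewrite -big_split/=.
  by apply: ler_sum => m _; exact: normc_hsdot_le.
have leA (B : {fset Lam}) : \sum_(m <- B) hsnorm2 (f m) <= a.
  apply: (cvgr_to_ge aP); exists B => // C /= BC.
  rewrite Re_sum; under [leRHS]eq_bigr do rewrite Re_hsdotxx.
  by apply: ler_sum_fset => // m; exact: hsnorm2_ge0.
have a0 : 0 <= a by apply: le_trans (leA fset0); rewrite big_seq_fset0.
rewrite /l2norm (_ : l2dot f f = a +i* b)//= sqr_sqrtr//; exact: leA.
Qed.

(** The bounds on finite partial sums pass to the limit since they hold
    uniformly in both finite sets. *)
Lemma bessel_single g (G : R -> 'M[R[i]]_n) (bo : R) f :
  0 < bo -> l2 g -> is_fourier g G ->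
  {ae mu, forall x, Om x -> Mnorm (G x) <= bo} -> l2 f ->
  (\esum_(l in [set: Lam]) (normc (l2dot f (displacement l g)) ^+ 2)%:E <=
   (bo ^+ 2 * l2norm f ^+ 2)%:E)%E.
Proof.
move=> bo0 gl2 gG Gbo fl2; apply: esum_le => L; have FF := @totally_filter Lam.
have [Mf fM] := l2_bounded fl2; have [Mg gM] := l2_bounded gl2.
pose c (A : {fset Lam}) l := \sum_(m <- A) hsdot (f m) (g (Lambda_shift l m)).
have /choice[a aP] : forall l, exists a : R * R,
    [/\ (fun A : {fset Lam} => complex.Re (c A l)) @ totally --> a.1,
        (fun A : {fset Lam} => complex.Im (c A l)) @ totally --> a.2 &
        l2dot f (displacement l g) = a.1 +i* a.2].
  move=> l.
  have [|a [b [aP bP dotE]]] :=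
    @sum_complex R Lam (fun m => hsdot (f m) (g (Lambda_shift l m))) (Mf + Mg).
    move=> B; apply: le_trans (lerD (fM B) (sum_shift_le l gM B)); rewrite -big_split/=.
    by apply: ler_sum => m _; exact: normc_hsdot_le.
  by exists (a, b); split.
have cvgc : (fun A => \sum_(l <- L) normc (c A l) ^+ 2) @ totally -->
    \sum_(l <- L) normc (l2dot f (displacement l g)) ^+ 2.
  apply: cvg_sum_seq => l; have [aP1 aP2 ->] := aP l.
  under eq_fun do rewrite normc2E.
  rewrite normc2E/=; apply: cvgD; rewrite expr2; under eq_fun do rewrite expr2; exact: cvgM.
apply: (cvgr_to_le cvgc); exists fset0 => // A _ /=.
apply: le_trans (finite_bessel f L A bo0 gG Gbo) _.
by rewrite ler_wpM2l ?sqr_ge0//; exact: l2norm2_ge.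
Qed.

End Bessel.

Unset Implicit Arguments.
Set Strict Implicit.

Theorem theorem2p4 (R : realType) (n N r p : nat)
    (n_gt0 : (0 < n)%N) (N_gt0 : (0 < N)%N)
    (r_odd : odd r) (r_coprime : coprime r N)
    (r_bounds : (1 <= r <= 2 * N - 1)%N)
    (p_gt0 : (0 < p)%N)
    (fs : 'I_p -> @Lambda R N r -> 'M[R[i]]_n)
    (fs_l2 : forall j : 'I_p, l2 (fs j))
    (fs_neq0 : forall j : 'I_p, fs j <> (fun=> 0))
    (Ffs : 'I_p -> R -> 'M[R[i]]_n)
    (Ffs_fourier : forall j : 'I_p, is_fourier (fs j) (Ffs j))
    (bo : R) (bo_gt0 : 0 < bo)
    (Ffs_bound : forall j : 'I_p,
       {ae lebesgue_measure, forall x : R,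
          @Omega R N x -> Mnorm (Ffs j x) <= bo}) :
  bessel_sequence fs (2 ^+ p.-1 * bo ^+ 2 * n%:R ^+ 2).
Proof.
(* Each of the p sequences contributes at most bo^2 |f|^2, and p <= 2^(p-1). *)
have n1 : 1 <= n%:R ^+ 2 :> R by rewrite exprn_ege1// ler1n.
have pexp : p%:R <= 2 ^+ p.-1 :> R.
  by rewrite -natrX ler_nat -[leqLHS](prednK p_gt0) ltn_expl.
split; first by rewrite !mulr_gt0 ?exprn_gt0// ltr0n.
move=> f fl2; apply: (@le_trans _ _ (\sum_(j < p) (bo ^+ 2 * l2norm f ^+ 2)%:E)%E).
  by apply: lee_sum => j _; exact: (bessel_single N_gt0 r_odd bo_gt0 (fs_l2 j) (Ffs_fourier j)).
rewrite sumEFin lee_fin sumr_const card_ord -[leLHS]mulr_natl mulrA.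
rewrite ler_wpM2r ?sqr_ge0//; apply: (@le_trans _ _ (2 ^+ p.-1 * bo ^+ 2)).
  by rewrite ler_wpM2r ?sqr_ge0.
by rewrite ler_peMr// mulr_ge0 ?sqr_ge0// exprn_ge0.
Qed.
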